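(* Let $\psi$ be a regular colouring. Then the coloured Kac-Moody algebra $U_h(\psi)$ is $\mathfrak b$-trivial. Moreover, it admits exactly one $\mathfrak b$-trivialization.
   Context: $\mathbb k$ is a field of characteristic zero, and $\mathbb k[[h]]$ is the ring of formal power series over $\mathbb k$. For a $\mathbb k$-vector space $V_0$, $V_0[[h]]$ denotes the module of formal series $\sum_{m\ge0}v_mh^m$ with $v_m\in V_0$. For a $\mathbb k[[h]]$-linear map $g$, $\bar g$ denotes the induced map modulo $h$. $\mathfrak a$ is the Lie algebra over $\mathbb k$ generated by $H,X^-,X^+$ subject to $[H,X^\pm]=\pm2X^\pm$. An $\mathfrak a$-algebra is an algebra with a structural homomorphism from $U(\mathfrak a)$. $U(\mathfrak{sl}_2)$ is an $\mathfrak a$-algebra via the canonical projection. We set $U_h(\mathfrak a):=U(\mathfrak a)[[h]]$. For a $U_h(\mathfrak a)$-algebra $A$, the quotient $A/hA$ is an $\mathfrak a$-algebra, and $U(\mathfrak{sl}_2)[[h]]/h\cong U(\mathfrak{sl}_2)$. A colouring is a sequence $\psi=(\psi^k)_{k\ge1}$ of functions $\psi^k:\mathbb Z\to\mathbb k[[h]]$ satisfying: - (C1) $\psi^k(n)\equiv k(n-k+1)\bmod h$; - (C2) $\psi^{n+1}(n)=0$ for all $n\ge0$; - (C3) $\psi^{n+k+1}(n)=\psi^k(-n-2)$ for all $k\ge1$ and all $n\ge0$. Write $\psi^k(n)=\sum_m\psi^k_m(n)h^m$. The colouring $\psi$ is regular if, for each $m$, there is $P_m\in\mathbb k[x,y]$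 with $\psi^k_m(n)=P_m(k,n)$ for all $k\ge1$ and $n\in\mathbb Z$. $V_h(n,\psi)$ is the representation of $U_h(\mathfrak a)$ on $(\bigoplus_{k\ge0}\mathbb k b_k)[[h]]$ with the following action: - $H.b_k=(n-2k)b_k$; - $X^-.b_k=b_{k+1}$; - $X^+.b_0=0$, and $X^+.b_k=\psi^k(n)b_{k-1}$ for $k\ge1$. $U_h(\psi)$ is the quotient of $U_h(\mathfrak a)$ by the two-sided ideal of elements that act by zero on all $V_h(n,\psi)$, $n\in\mathbb Z$. The images of $H,X^\pm$ in it are again denoted $H,X^\pm$. A $\mathfrak b$-trivialization of $U_h(\psi)$ is a $\mathbb k[[h]]$-algebra isomorphism $g:U(\mathfrak{sl}_2)[[h]]\to U_h(\psi)$ such that $g(H)=H$, $g(X^-)=X^-$, and $\bar g:U(\mathfrak{sl}_2)\to U_h(\psi)/hU_h(\psi)$ is an isomorphism of $\mathfrak a$-algebras. $U_h(\psi)$ is $\mathfrak b$-trivial if it admits a $\mathfrak b$-trivialization. *)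

(* Defs.v *)
From HB Require Import structures.
From mathcomp Require Import all_boot all_order all_algebra.
Set Implicit Arguments. Unset Strict Implicit. Unset Printing Implicit Defensive.
Import Order.TTheory GRing.Theory Num.Theory.
Local Open Scope ring_scope.

(* Letters of the free algebra k<H, X^-, X^+>. *)
Definition letter := 'I_3.
Definition lH : letter := @Ordinal 3 0 isT.
Definition lXm : letter := @Ordinal 3 1 isT.
Definition lXp : letter := @Ordinal 3 2 isT.
Definition ncword := seq letter.
(* word [:: a1; ...; ar] stands for the product a1 a2 ... ar *)

Section Defs.
Variable K : fieldType.

(* Noncommutative polynomials (elements of the free algebra), as formal
   finite linear combinations of words. *)
Definition ncpoly := seq (K * ncword).

Definition nc_coef (p : ncpoly) (w : ncword) : K := \sum_(t <- p | t.2 == w) t.1.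
Definition nc_zero : ncpoly := [::].
Definition nc_one : ncpoly := [:: (1, [::])].
Definition nc_gen (x : letter) : ncpoly := [:: (1, [:: x])].
Definition nc_add (p q : ncpoly) : ncpoly := p ++ q.
Definition nc_scale (a : K) (p : ncpoly) : ncpoly := [seq (a * t.1, t.2) | t <- p].
Definition nc_opp (p : ncpoly) : ncpoly := nc_scale (-1) p.
Definition nc_mul (p q : ncpoly) : ncpoly :=
  [seq (s.1 * t.1, s.2 ++ t.2) | s <- p, t <- q].
Definition nc_comm (p q : ncpoly) : ncpoly := nc_add (nc_mul p q) (nc_opp (nc_mul q p)).

Inductive nc_ideal (R : seq ncpoly) : ncpoly -> Prop :=
| ncI_null p : (forall w, nc_coef p w = 0) -> nc_ideal R p
| ncI_gen a r b : r \in R -> nc_ideal R (nc_mul (nc_mul a r) b)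
| ncI_add p q : nc_ideal R p -> nc_ideal R q -> nc_ideal R (nc_add p q)
| ncI_ext p q : nc_ideal R p -> (forall w, nc_coef p w = nc_coef q w) -> nc_ideal R q.

Definition ncH := nc_gen lH.
Definition ncXm := nc_gen lXm.
Definition ncXp := nc_gen lXp.

Definition rel_a : seq ncpoly :=
  [:: nc_add (nc_comm ncH ncXp) (nc_scale (-2) ncXp);
      nc_add (nc_comm ncH ncXm) (nc_scale 2 ncXm)].
Definition rel_sl2 : seq ncpoly :=
  rel_a ++ [:: nc_add (nc_comm ncXp ncXm) (nc_opp ncH)].

Definition sl2_eq (p q : ncpoly) : Prop := nc_ideal rel_sl2 (nc_add p (nc_opp q)).

(* Formal power series in h with coefficients in the free algebra. *)
Definition ncser := nat -> ncpoly.
Definition ser_add (x y : ncser) : ncser := fun m => nc_add (x m) (y m).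
Definition ser_opp (x : ncser) : ncser := fun m => nc_opp (x m).
Definition ser_mul (x y : ncser) : ncser :=
  fun m => \big[nc_add/nc_zero]_(i < m.+1) nc_mul (x i) (y (m - i)%N).
Definition ser_scale (c : nat -> K) (x : ncser) : ncser :=
  fun m => \big[nc_add/nc_zero]_(i < m.+1) nc_scale (c i) (x (m - i)%N).
Definition ser_const (u : ncpoly) : ncser := fun m => if m == 0%N then u else nc_zero.
Definition ser_one : ncser := ser_const nc_one.
Definition ser_h (x : ncser) : ncser := fun m => if m is m'.+1 then x m' else nc_zero.

Definition Usl2h_eq (x y : ncser) : Prop := forall m, sl2_eq (x m) (y m).
Definition Usl2h_modh (x y : ncser) : Prop :=
  exists w, Usl2h_eq (ser_add x (ser_opp y)) (ser_h w).

(* Colourings: psi k n m is the coefficient of h^m in psi^k(n) (k >= 1). *)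
Definition colouring (psi : nat -> int -> nat -> K) : Prop :=
  [/\ (forall (k : nat) (n : int), (0 < k)%N ->
         psi k n 0%N = k%:R * (n - k%:Z + 1)%:~R),
      (forall (n m : nat), psi n.+1 n%:Z m = 0) &
      (forall (k n m : nat), (0 < k)%N ->
         psi (n + k).+1 n%:Z m = psi k (- n%:Z - 2) m)].

Definition regular_colouring (psi : nat -> int -> nat -> K) : Prop :=
  forall m : nat, exists P : {poly {poly K}},
    forall (k : nat) (n : int), (0 < k)%N -> psi k n m = (P.[(n%:~R)%:P]).[k%:R].

(* The module V_h(n, psi) = (\oplus_k k b_k)[[h]]:
   v m k = coefficient of h^m b_k; for each m only finitely many k. *)
Definition vec := nat -> nat -> K.
Definition fin_supp (v : vec) : Prop :=
  forall m, exists N, forall k, (N <= k)%N -> v m k = 0.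

Definition letter_act (psi : nat -> int -> nat -> K) (n : int) (a : letter) (v : vec) : vec :=
  fun m k =>
    if a == lH then (n - 2 * k%:Z)%:~R * v m k
    else if a == lXm then (if k is k'.+1 then v m k' else 0)
    else \sum_(i < m.+1) psi k.+1 n i * v (m - i)%N k.+1.

Definition word_act psi n (w : ncword) (v : vec) : vec := foldr (letter_act psi n) v w.
Definition nc_act psi n (p : ncpoly) (v : vec) : vec :=
  fun m k => \sum_(t <- p) t.1 * word_act psi n t.2 v m k.
Definition ser_act psi n (x : ncser) (v : vec) : vec :=
  fun m k => \sum_(i < m.+1) nc_act psi n (x i) v (m - i)%N k.

(* Equality in U_h(psi): the difference acts by zero on every V_h(n,psi). *)
Definition Uhpsi_eq psi (x y : ncser) : Prop :=
  forall (n : int) (v : vec), fin_supp v ->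
    forall m k, ser_act psi n (ser_add x (ser_opp y)) v m k = 0.
Definition Uhpsi_modh psi (x y : ncser) : Prop :=
  exists w, Uhpsi_eq psi (ser_add x (ser_opp y)) (ser_h w).

(* b-trivializations, as maps on representatives U(sl2)[[h]] -> U_h(psi). *)
Definition b_trivialization psi (g : ncser -> ncser) : Prop :=
  [/\
      (forall x y, Usl2h_eq x y -> Uhpsi_eq psi (g x) (g y)),
      [/\ (forall x y, Uhpsi_eq psi (g (ser_add x y)) (ser_add (g x) (g y))),
          (forall c x, Uhpsi_eq psi (g (ser_scale c x)) (ser_scale c (g x))),
          (forall x y, Uhpsi_eq psi (g (ser_mul x y)) (ser_mul (g x) (g y))) &
          Uhpsi_eq psi (g ser_one) ser_one],
      (forall x y, Uhpsi_eq psi (g x) (g y) -> Usl2h_eq x y) /\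
      (forall y, exists x, Uhpsi_eq psi (g x) y),
      Uhpsi_eq psi (g (ser_const ncH)) (ser_const ncH) /\
      Uhpsi_eq psi (g (ser_const ncXm)) (ser_const ncXm) &
      (* gbar : U(sl2) -> U_h(psi)/h is an isomorphism of a-algebras *)
      [/\ (forall u : ncpoly, Uhpsi_modh psi (g (ser_const u)) (ser_const u)),
          (forall x y, Uhpsi_modh psi (g x) (g y) -> Usl2h_modh x y) &
          (forall y, exists x, Uhpsi_modh psi (g x) y)]].

End Defs.

(* Main.v *)
Require Import Defs.
From HB Require Import structures.
From Stdlib Require Import FunctionalExtensionality IndefiniteDescription.
From mathcomp Require Import all_boot all_order all_algebra.
From mathcomp Require Import ring zify.
Set Implicit Arguments. Unset Strict Implicit. Unset Printing Implicit Defensive.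
Import GRing.Theory.
Local Open Scope ring_scope.

(** Let M(n) be the Verma modules of sl_2, i.e. V_h(n, psi) for the undeformed
    colouring k(n - k + 1).  A b-trivialization g is forced to satisfy: g(x) acts
    on V_h(n, psi) as x acts on M(n)[[h]].  Indeed the difference D between g(X^+)
    and the Verma operator X^+ commutes with X^- and satisfies [H, D] = 2D, so
    D b_0 has weight n + 2, hence vanishes.  This gives uniqueness.

    For existence, regularity and (C2), (C3) say that the coefficients of psi are
    polynomials in (k, n), invariant under (k, n) -> (k - n - 1, - n - 2) and vanishing
    at k = n + 1; hence they are k(n - k + 1) G_m(n - 2k, k(n - k + 1)), and
    X^+ acts on V_h(n, psi) as the series sum_m h^m X^+ G_m(H, X^- X^+) of U(sl_2)[[h]]
    does on M(n)[[h]].  This substitution is the identity modulo h, so it can be inverted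
    h-adically, and faithfulness of U(sl_2) on the family M(n) makes the inverse a
    trivialization. *)

(** * Double sums over the triangle i + j <= m *)

Section TriangularSums.
Variable (V : nmodType).

(** Diagonals give the coefficients of a Cauchy product of series, rows those of one action applied
    after another. *)
Lemma sum_triangle_diag (f : nat -> nat -> V) m :
  \sum_(j < m.+1) \sum_(i < j.+1) f i (j - i)%N =
  \sum_(i < m.+1) \sum_(j < (m - i).+1) f i j.
Proof.
elim: m => [|m IH]; first by rewrite !big_ord_recl !big_ord0.
rewrite big_ord_recr /= IH [in RHS]big_ord_recr /= subnn big_ord1.
rewrite [X in _ + X]big_ord_recr /= subnn addrA -big_split /=; congr (_ + _).
by apply: eq_bigr => i _; rewrite subSn -1?ltnS // [RHS]big_ord_recr.
Qed.

Lemma sum_triangle_exchange (f : nat -> nat -> V) m :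
  \sum_(i < m.+1) \sum_(j < (m - i).+1) f i j =
  \sum_(j < m.+1) \sum_(i < (m - j).+1) f i j.
Proof.
rewrite -!sum_triangle_diag -(sum_triangle_diag (fun j i => f i j)).
apply: eq_bigr => j _; rewrite (reindex_inj rev_ord_inj) /=.
by apply: eq_bigr => i _; rewrite subSS subKn // -ltnS.
Qed.

End TriangularSums.

(** * The actions of words, polynomials and series on V_h(n, psi) *)

Section Actions.
Variable K : fieldType.
Implicit Types (psi : nat -> int -> nat -> K) (n : int) (p q : ncpoly K).
Implicit Types (u v : vec K) (x y : ncser K) (c : K) (w : ncword).

Definition vec0 : vec K := fun _ _ => 0.
Definition vec_add u v : vec K := fun m k => u m k + v m k.
Definition vec_scale c v : vec K := fun m k => c * v m k.
Definition vec_h v : vec K := fun m k => if m is m'.+1 then v m' k else 0.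
(** The h-adically convergent sum of the h^i f_i. *)
Definition vec_series (f : nat -> vec K) : vec K :=
  fun m k => \sum_(i < m.+1) f i (m - i)%N k.

Lemma vec_eq u v : (forall m k, u m k = v m k) -> u = v.
Proof.
by move=> uv; apply: functional_extensionality => m;
   apply: functional_extensionality.
Qed.

Lemma ser_actE psi n x v :
  ser_act psi n x v = vec_series (fun i => nc_act psi n (x i) v).
Proof. by []. Qed.

Section FixedModule.
Variables (psi : nat -> int -> nat -> K) (n : int).
Local Notation la := (letter_act psi n).
Local Notation wa := (word_act psi n).
Local Notation na := (nc_act psi n).
Local Notation sa := (ser_act psi n).

Lemma letter_act_add a u v : la a (vec_add u v) = vec_add (la a u) (la a v).
Proof.
apply: vec_eq => m k; rewrite /letter_act /vec_add.
case: ifP => _; first by rewrite mulrDr.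
case: ifP => _; first by case: k => [|k] //; rewrite addr0.
by rewrite -big_split; apply: eq_bigr => i _; rewrite mulrDr.
Qed.

Lemma letter_act_scale a c v : la a (vec_scale c v) = vec_scale c (la a v).
Proof.
apply: vec_eq => m k; rewrite /letter_act /vec_scale.
case: ifP => _; first by rewrite mulrCA.
case: ifP => _; first by case: k => [|k] //; rewrite mulr0.
by rewrite big_distrr; apply: eq_bigr => i _; rewrite /= mulrCA.
Qed.

Lemma letter_act_series a f :
  la a (vec_series f) = vec_series (fun i => la a (f i)).
Proof.
apply: vec_eq => m k; rewrite /letter_act /vec_series.
case: ifP => _; first by rewrite big_distrr.
case: ifP => _; first by case: k => [|k] //; rewrite big1.
under eq_bigr => i _ do rewrite big_distrr /=.
rewrite (sum_triangle_exchange (fun i j => psi k.+1 n i * f j (m - i - j)%N k.+1)).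
by apply: eq_bigr => j _; apply: eq_bigr => i _; rewrite subnAC.
Qed.

Lemma letter_act_h a v : la a (vec_h v) = vec_h (la a v).
Proof.
apply: vec_eq => m k; rewrite /letter_act /vec_h.
case: ifP => _; first by case: m => [|m] //; rewrite mulr0.
case: ifP => _; first by case: m => [|m] //; case: k.
case: m => [|m]; first by rewrite big_ord_recl big_ord0 mulr0 addr0.
rewrite big_ord_recr /= subnn mulr0 addr0.
by apply: eq_bigr => i _; rewrite subSn // -ltnS.
Qed.

Lemma word_act_add w u v : wa w (vec_add u v) = vec_add (wa w u) (wa w v).
Proof. by elim: w => //= a w IH; rewrite -[LHS]/(la a (wa w _)) IH letter_act_add. Qed.

Lemma word_act_scale w c v : wa w (vec_scale c v) = vec_scale c (wa w v).
Proof. by elim: w => //= a w IH; rewrite -[LHS]/(la a (wa w _)) IH letter_act_scale. Qed.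

Lemma word_act_series w f : wa w (vec_series f) = vec_series (fun i => wa w (f i)).
Proof. by elim: w => //= a w IH; rewrite -[LHS]/(la a (wa w _)) IH letter_act_series. Qed.

Lemma word_act_h w v : wa w (vec_h v) = vec_h (wa w v).
Proof. by elim: w => //= a w IH; rewrite -[LHS]/(la a (wa w _)) IH letter_act_h. Qed.

Lemma nc_act_vadd p u v : na p (vec_add u v) = vec_add (na p u) (na p v).
Proof.
apply: vec_eq => m k; rewrite /nc_act /vec_add -big_split.
by apply: eq_bigr => t _; rewrite word_act_add /vec_add mulrDr.
Qed.

Lemma nc_act_vscale p c v : na p (vec_scale c v) = vec_scale c (na p v).
Proof.
apply: vec_eq => m k; rewrite /nc_act /vec_scale big_distrr.
by apply: eq_bigr => t _; rewrite word_act_scale /vec_scale mulrCA.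
Qed.

Lemma nc_act_vseries p f : na p (vec_series f) = vec_series (fun i => na p (f i)).
Proof.
apply: vec_eq => m k; rewrite /nc_act /vec_series exchange_big /=.
by apply: eq_bigr => t _; rewrite word_act_series /vec_series big_distrr.
Qed.

Lemma nc_act_vh p v : na p (vec_h v) = vec_h (na p v).
Proof.
apply: vec_eq => m k; rewrite /nc_act /vec_h.
case: m => [|m]; last by apply: eq_bigr => t _; rewrite word_act_h.
by rewrite big1 // => t _; rewrite word_act_h mulr0.
Qed.

Lemma nc_act_vsum p (I : Type) (r : seq I) (F : I -> vec K) :
  na p (fun m k => \sum_(i <- r) F i m k) =
  fun m k => \sum_(i <- r) na p (F i) m k.
Proof.
elim: r => [|i r IH].
  transitivity (na p (vec_scale 0 vec0)).
    by congr (na p _); apply: vec_eq => m k; rewrite big_nil /vec_scale mul0r.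
  by rewrite nc_act_vscale; apply: vec_eq => m k; rewrite big_nil /vec_scale mul0r.
transitivity (na p (vec_add (F i) (fun m k => \sum_(j <- r) F j m k))).
  by congr (na p _); apply: vec_eq => m k; rewrite big_cons.
by rewrite nc_act_vadd IH; apply: vec_eq => m k; rewrite big_cons.
Qed.

Lemma nc_act_add p q v : na (nc_add p q) v = vec_add (na p v) (na q v).
Proof. by apply: vec_eq => m k; rewrite /nc_act /nc_add big_cat. Qed.

Lemma nc_act_scale c p v : na (nc_scale c p) v = vec_scale c (na p v).
Proof.
apply: vec_eq => m k; rewrite /nc_act /nc_scale big_map /vec_scale big_distrr.
by apply: eq_bigr => t _; rewrite /= mulrA.
Qed.

Lemma nc_act_opp p v : na (nc_opp p) v = vec_scale (-1) (na p v).
Proof. exact: nc_act_scale. Qed.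

Lemma nc_act_word w v : na [:: (1, w)] v = wa w v.
Proof. by apply: vec_eq => m k; rewrite /nc_act big_seq1 mul1r. Qed.

Lemma nc_act_gen a v : na (nc_gen K a) v = la a v.
Proof. exact: nc_act_word. Qed.

Lemma nc_act_one v : na (nc_one K) v = v.
Proof. exact: nc_act_word. Qed.

Lemma nc_act_nil v : na (nc_zero K) v = vec0.
Proof. by apply: vec_eq => m k; rewrite /nc_act big_nil. Qed.

Lemma word_act_cat w1 w2 v : wa (w1 ++ w2) v = wa w1 (wa w2 v).
Proof. by rewrite /word_act foldr_cat. Qed.

Lemma nc_act_mul p q v : na (nc_mul p q) v = na p (na q v).
Proof.
apply: vec_eq => m k; rewrite {1}/nc_act /nc_mul big_allpairs_dep.
apply: eq_bigr => s _; rewrite -(nc_act_word s.2).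
rewrite (nc_act_vsum _ q (fun t => vec_scale t.1 (wa t.2 v))) big_distrr /=.
apply: eq_bigr => t _; rewrite nc_act_vscale nc_act_word /vec_scale.
by rewrite word_act_cat mulrA.
Qed.

Lemma nc_act_big (I : Type) (r : seq I) (F : I -> ncpoly K) v m k :
  na (\big[@nc_add K/nc_zero K]_(i <- r) F i) v m k = \sum_(i <- r) na (F i) v m k.
Proof.
elim: r => [|i r IH]; first by rewrite !big_nil nc_act_nil.
by rewrite !big_cons nc_act_add /vec_add IH.
Qed.

Lemma ser_act_vadd x u v : sa x (vec_add u v) = vec_add (sa x u) (sa x v).
Proof.
apply: vec_eq => m k; rewrite /ser_act /vec_add -big_split.
by apply: eq_bigr => i _; rewrite nc_act_vadd.
Qed.

Lemma ser_act_vscale x c v : sa x (vec_scale c v) = vec_scale c (sa x v).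
Proof.
apply: vec_eq => m k; rewrite /ser_act /vec_scale big_distrr.
by apply: eq_bigr => i _; rewrite nc_act_vscale.
Qed.

Lemma ser_act_vh x v : sa x (vec_h v) = vec_h (sa x v).
Proof.
apply: vec_eq => m k; rewrite /ser_act {2}/vec_h.
case: m => [|m]; first by rewrite big_ord_recl big_ord0 nc_act_vh addr0.
rewrite big_ord_recr /= subnn nc_act_vh addr0.
by apply: eq_bigr => i _; rewrite nc_act_vh subSn // -ltnS.
Qed.

Lemma ser_act_add x y v : sa (ser_add x y) v = vec_add (sa x v) (sa y v).
Proof.
apply: vec_eq => m k; rewrite /ser_act /vec_add -big_split.
by apply: eq_bigr => i _; rewrite nc_act_add.
Qed.

Lemma ser_act_opp x v : sa (ser_opp x) v = vec_scale (-1) (sa x v).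
Proof.
apply: vec_eq => m k; rewrite /ser_act /vec_scale big_distrr.
by apply: eq_bigr => i _; rewrite nc_act_opp.
Qed.

Lemma ser_act_mul x y v : sa (ser_mul x y) v = sa x (sa y v).
Proof.
apply: vec_eq => m k; rewrite !ser_actE {1 2}/vec_series.
under eq_bigr => j _ do rewrite nc_act_big.
under [RHS]eq_bigr => i _ do rewrite nc_act_vseries.
rewrite /vec_series -(sum_triangle_diag (fun i j => na (x i) (na (y j) v) (m - i - j)%N k)).
apply: eq_bigr => j _; apply: eq_bigr => i _.
by rewrite nc_act_mul -subnDA subnKC // -ltnS.
Qed.

Lemma ser_act_scale (c : nat -> K) x v m k :
  sa (ser_scale c x) v m k = \sum_(i < m.+1) c i * sa x v (m - i)%N k.
Proof.
rewrite /ser_act.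
under eq_bigr => j _ do rewrite nc_act_big.
under [RHS]eq_bigr => i _ do rewrite big_distrr /=.
rewrite -(sum_triangle_diag (fun i j => c i * na (x j) v (m - i - j)%N k)).
apply: eq_bigr => j _; apply: eq_bigr => i _.
by rewrite nc_act_scale -subnDA subnKC // -ltnS.
Qed.

Lemma ser_act_const p v : sa (ser_const p) v = na p v.
Proof.
apply: vec_eq => m k; rewrite /ser_act big_ord_recl big1 ?addr0 ?subn0 //.
by move=> i _; rewrite nc_act_nil.
Qed.

Lemma ser_act_one v : sa (ser_one K) v = v.
Proof. by rewrite ser_act_const nc_act_one. Qed.

Lemma ser_act_h x v : sa (ser_h x) v = vec_h (sa x v).
Proof.
apply: vec_eq => m k; rewrite /ser_act big_ord_recl nc_act_nil add0r.
case: m => [|m]; first by rewrite big_ord0.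
by apply: eq_bigr => i _.
Qed.

Lemma ser_act_ext x y v : (forall i, na (x i) v = na (y i) v) -> sa x v = sa y v.
Proof.
by move=> xy; apply: vec_eq => m k; apply: eq_bigr => i _; rewrite xy.
Qed.

Lemma fin_supp_letter a v : fin_supp v -> fin_supp (la a v).
Proof.
move=> fv m; rewrite /letter_act.
case: (a == lH).
  by have [N hN] := fv m; exists N => k Nk; rewrite hN ?mulr0.
case: (a == lXm).
  by have [N hN] := fv m; exists N.+1 => -[|k] // Nk; rewrite hN.
(* The h^m coefficient of X^+ v involves v_0, ..., v_m, so their supports need a common bound. *)
have [N hN] : exists N, forall i, (i <= m)%N -> forall k, (N <= k)%N -> v i k = 0.
  elim: m => [|m [N hN]].
    by have [N hN] := fv 0%N; exists N => i; rewrite leqn0 => /eqP ->.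
  have [N' hN'] := fv m.+1; exists (maxn N N') => i.
  rewrite leq_eqVlt => /orP[/eqP -> k|im k]; rewrite geq_max => /andP[h1 h2].
    exact: hN'.
  by apply: hN.
exists N => k Nk; rewrite big1 // => i _; rewrite hN ?mulr0 ?leq_subr //.
exact: leqW.
Qed.

Lemma fin_supp_word w v : fin_supp v -> fin_supp (wa w v).
Proof. by move=> fv; elim: w => //= a w IH; apply: fin_supp_letter. Qed.

Lemma fin_supp_sum (I : Type) (r : seq I) (F : I -> nat -> K) :
  (forall i, exists N, forall k, (N <= k)%N -> F i k = 0) ->
  exists N, forall k, (N <= k)%N -> \sum_(i <- r) F i k = 0.
Proof.
move=> hF; elim: r => [|i r [N hN]]; first by exists 0%N => k _; rewrite big_nil.
have [N' hN'] := hF i; exists (maxn N N') => k; rewrite geq_max => /andP[h1 h2].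
by rewrite big_cons hN // hN' // addr0.
Qed.

Lemma fin_supp_nc p v : fin_supp v -> fin_supp (na p v).
Proof.
move=> fv m; apply: fin_supp_sum => t; have [N hN] := @fin_supp_word t.2 v fv m.
by exists N => k Nk; rewrite hN ?mulr0.
Qed.

Lemma fin_supp_ser x v : fin_supp v -> fin_supp (sa x v).
Proof. by move=> fv m; apply: fin_supp_sum => i; apply: fin_supp_nc. Qed.

End FixedModule.

Lemma Uhpsi_eqP psi x y :
  Uhpsi_eq psi x y <->
  forall n v, fin_supp v -> ser_act psi n x v = ser_act psi n y v.
Proof.
split=> [xy n v fv|xy n v fv m k].
  apply: vec_eq => m k; apply/eqP; rewrite -subr_eq0 -mulN1r.
  by have /eqP := xy n v fv m k; rewrite ser_act_add ser_act_opp.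
by rewrite ser_act_add ser_act_opp /vec_add /vec_scale xy // mulN1r subrr.
Qed.

(** A list may repeat words. Collecting equal words shows that a linear functional depends only on
    the coefficients [nc_coef]. *)
Lemma sum_nc_coef p (F : ncword -> K) :
  \sum_(t <- p) t.1 * F t.2 =
  \sum_(w <- undup [seq t.2 | t <- p]) nc_coef p w * F w.
Proof.
rewrite /nc_coef; under [RHS]eq_bigr => w _ do rewrite big_distrl /= big_mkcond.
rewrite exchange_big /= big_seq [RHS]big_seq; apply: eq_bigr => t tp.
rewrite (bigD1_seq t.2) ?undup_uniq ?mem_undup ?map_f //= eqxx.
by rewrite big1 ?addr0 // => w; rewrite eq_sym => /negbTE ->.
Qed.

End Actions.

(** * The relations of U(sl_2) and spanning by Poincare-Birkhoff-Witt monomials *)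

Section Presentation.
Variable K : fieldType.
Implicit Types (p q r : ncpoly K) (w : ncword) (F : ncword -> K).

(** The linear functional on the free algebra with values F on words. An identity between
    noncommutative polynomials is checked on all F, where it becomes an identity in K. *)
Definition nc_eval F p : K := \sum_(t <- p) t.1 * F t.2.

Lemma nc_coef_eval p w : nc_coef p w = nc_eval (fun w' => (w' == w)%:R) p.
Proof.
rewrite /nc_coef /nc_eval big_mkcond; apply: eq_bigr => t _.
by case: eqP; rewrite ?mulr1 ?mulr0.
Qed.

Lemma nc_eval_add F p q : nc_eval F (nc_add p q) = nc_eval F p + nc_eval F q.
Proof. by rewrite /nc_eval /nc_add big_cat. Qed.

Lemma nc_eval_scale F c p : nc_eval F (nc_scale c p) = c * nc_eval F p.
Proof.
by rewrite /nc_eval big_map big_distrr; apply: eq_bigr => t _; rewrite /= mulrA.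
Qed.

Lemma nc_eval_opp F p : nc_eval F (nc_opp p) = - nc_eval F p.
Proof. by rewrite nc_eval_scale mulN1r. Qed.

Lemma nc_eval_mul F p q :
  nc_eval F (nc_mul p q) =
  nc_eval (fun w1 => nc_eval (fun w2 => F (w1 ++ w2)) q) p.
Proof.
rewrite /nc_eval big_allpairs_dep; apply: eq_bigr => s _.
by rewrite big_distrr; apply: eq_bigr => t _; rewrite /= mulrA.
Qed.

Lemma nc_eval_word F w : nc_eval F [:: (1, w)] = F w.
Proof. by rewrite /nc_eval big_seq1 mul1r. Qed.

Lemma nc_eval_gen F a : nc_eval F (nc_gen K a) = F [:: a].
Proof. exact: nc_eval_word. Qed.

Lemma nc_eval_nil F : nc_eval F [::] = 0.
Proof. by rewrite /nc_eval big_nil. Qed.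

Lemma nc_eval_cons F t p : nc_eval F (t :: p) = t.1 * F t.2 + nc_eval F p.
Proof. by rewrite /nc_eval big_cons. Qed.

Lemma nc_eval_null F p : (forall w, nc_coef p w = 0) -> nc_eval F p = 0.
Proof. by move=> p0; rewrite /nc_eval sum_nc_coef big1 // => w _; rewrite p0 mul0r. Qed.

Lemma nc_eval_coef F p q :
  (forall w, nc_coef p w = nc_coef q w) -> nc_eval F p = nc_eval F q.
Proof.
move=> pq; apply/eqP; rewrite -subr_eq0 -nc_eval_opp -nc_eval_add; apply/eqP.
apply: nc_eval_null => w.
by rewrite nc_coef_eval nc_eval_add nc_eval_opp -!nc_coef_eval pq subrr.
Qed.

Definition nc_evalE :=
  (nc_eval_add, nc_eval_opp, nc_eval_scale, nc_eval_mul, nc_eval_gen, nc_eval_word,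
   nc_eval_nil, nc_eval_cons).

Lemma eq_nc_eval F1 F2 p : (forall w, F1 w = F2 w) -> nc_eval F1 p = nc_eval F2 p.
Proof. by move=> F12; apply: eq_bigr => t _; rewrite F12. Qed.

Lemma nc_eval_mulDr F r p q :
  nc_eval F (nc_mul r (nc_add p q)) = nc_eval F (nc_mul r p) + nc_eval F (nc_mul r q).
Proof.
rewrite !nc_eval_mul /nc_eval -big_split; apply: eq_bigr => t _.
by rewrite big_cat mulrDr.
Qed.

Lemma nc_eval_mulZr F r c p :
  nc_eval F (nc_mul r (nc_scale c p)) = c * nc_eval F (nc_mul r p).
Proof.
rewrite !nc_eval_mul [in RHS]/nc_eval big_distrr; apply: eq_bigr => t _ /=.
by rewrite -/(nc_eval _ _) nc_eval_scale mulrCA.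
Qed.

Lemma nc_ideal_eval (R : seq (ncpoly K)) p q :
  nc_ideal R p -> (forall F, nc_eval F p = nc_eval F q) -> nc_ideal R q.
Proof. by move=> Ip pq; apply: (ncI_ext Ip) => w; rewrite !nc_coef_eval. Qed.

Lemma nc_ideal_null (R : seq (ncpoly K)) p :
  (forall F, nc_eval F p = 0) -> nc_ideal R p.
Proof. by move=> p0; apply: ncI_null => w; rewrite nc_coef_eval. Qed.

(** In a generator a r b the left factor is absorbed into a; the other constructors are handled by
    linearity. *)
Lemma nc_ideal_mull (R : seq (ncpoly K)) p q : nc_ideal R p -> nc_ideal R (nc_mul q p).
Proof.
elim=> {p} [p p0|a r b rR|p1 p2 _ I1 _ I2|p1 p2 _ I1 p12].
- apply: nc_ideal_null => F; rewrite nc_eval_mul (eq_nc_eval (F2 := fun=> 0)).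
    by rewrite /nc_eval big1 // => t _; rewrite mulr0.
  by move=> w; apply: nc_eval_null.
- apply: (nc_ideal_eval (ncI_gen (nc_mul q a) b rR)) => F.
  rewrite !nc_eval_mul; apply: eq_nc_eval => w1; rewrite !nc_eval_mul.
  do 3!(apply: eq_nc_eval => ?); by rewrite !catA.
- apply: (nc_ideal_eval (ncI_add I1 I2)) => F.
  by rewrite nc_eval_mulDr nc_eval_add.
- apply: (nc_ideal_eval I1) => F; rewrite !nc_eval_mul; apply: eq_nc_eval => w1.
  exact: nc_eval_coef.
Qed.

Lemma nc_ideal_scale (R : seq (ncpoly K)) c p : nc_ideal R p -> nc_ideal R (nc_scale c p).
Proof.
move=> /(nc_ideal_mull [:: (c, [::])]) Ip; apply: (nc_ideal_eval Ip) => F.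
by rewrite !nc_evalE addr0.
Qed.

Lemma sl2_eq_eval p q : (forall F, nc_eval F p = nc_eval F q) -> sl2_eq p q.
Proof. by move=> pq; apply: nc_ideal_null => F; rewrite !nc_evalE pq subrr. Qed.

Lemma sl2_eq_trans p q r : sl2_eq p q -> sl2_eq q r -> sl2_eq p r.
Proof.
move=> pq qr; apply: (nc_ideal_eval (ncI_add pq qr)) => F; rewrite !nc_evalE; ring.
Qed.

Lemma sl2_eq_add p1 p2 q1 q2 :
  sl2_eq p1 q1 -> sl2_eq p2 q2 -> sl2_eq (nc_add p1 p2) (nc_add q1 q2).
Proof.
move=> e1 e2; apply: (nc_ideal_eval (ncI_add e1 e2)) => F; rewrite !nc_evalE; ring.
Qed.

Lemma sl2_eq_scale c p q : sl2_eq p q -> sl2_eq (nc_scale c p) (nc_scale c q).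
Proof.
move=> /(nc_ideal_scale c) e; apply: (nc_ideal_eval e) => F; rewrite !nc_evalE; ring.
Qed.

Lemma sl2_eq_mull r p q : sl2_eq p q -> sl2_eq (nc_mul r p) (nc_mul r q).
Proof.
move=> /(nc_ideal_mull r) e; apply: (nc_ideal_eval e) => F.
by rewrite nc_eval_mulDr nc_eval_add nc_eval_opp nc_eval_mulZr mulN1r.
Qed.

(** The monomial (X^-)^a H^b (X^+)^c. With X^+ on the right, the lowering of the index k is applied
    first to a basis vector b_k. *)
Definition pbw (a b c : nat) : ncword := nseq a lXm ++ nseq b lH ++ nseq c lXp.

Definition pbw_form p := forall t, t \in p -> exists a b c, t.2 = pbw a b c.
Definition pbw_span p := exists2 q, pbw_form q & sl2_eq p q.

Lemma pbw_span_eq p q : sl2_eq p q -> pbw_span q -> pbw_span p.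
Proof. by move=> pq [r rf qr]; exists r => //; apply: sl2_eq_trans pq qr. Qed.

Lemma pbw_span_eval p q : (forall F, nc_eval F p = nc_eval F q) -> pbw_span q -> pbw_span p.
Proof. by move=> /sl2_eq_eval; apply: pbw_span_eq. Qed.

Lemma pbw_span_add p q : pbw_span p -> pbw_span q -> pbw_span (nc_add p q).
Proof.
move=> [p' fp pp'] [q' fq qq']; exists (nc_add p' q'); last exact: sl2_eq_add.
by move=> t; rewrite mem_cat => /orP[/fp|/fq].
Qed.

Lemma pbw_span_scale c p : pbw_span p -> pbw_span (nc_scale c p).
Proof.
move=> [p' fp pp']; exists (nc_scale c p'); last exact: sl2_eq_scale.
by move=> _ /mapP[t /fp tp ->].
Qed.

Lemma pbw_span_word a b c : pbw_span [:: (1, pbw a b c)].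
Proof.
exists [:: (1, pbw a b c)]; last exact: sl2_eq_eval.
by move=> t; rewrite inE => /eqP ->; exists a, b, c.
Qed.

Lemma pbw_span_mull r :
  (forall a b c, pbw_span (nc_mul r [:: (1, pbw a b c)])) ->
  forall p, pbw_span p -> pbw_span (nc_mul r p).
Proof.
move=> rs p [q fq pq]; apply: (pbw_span_eq (sl2_eq_mull r pq)) => {p pq}.
elim: q fq => [_|t q IH fq].
  exists [::] => //; apply: sl2_eq_eval => F; rewrite nc_eval_mul /nc_eval.
  by rewrite big_nil big1 // => s _; rewrite big_nil mulr0.
have [a [b [c tE]]] := fq t (mem_head _ _).
apply: (pbw_span_eval (q := nc_add (nc_scale t.1 (nc_mul r [:: (1, pbw a b c)])) (nc_mul r q))).
  move=> F; rewrite nc_eval_add nc_eval_scale -nc_eval_mulZr -nc_eval_mulDr !nc_eval_mul.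
  by apply: eq_nc_eval => w; rewrite !nc_evalE -tE.
apply: pbw_span_add; first by apply: pbw_span_scale.
by apply: IH => s sq; apply: fq; rewrite inE sq orbT.
Qed.

Lemma pbw_span_Xm p : pbw_span p -> pbw_span (nc_mul (ncXm K) p).
Proof.
apply: pbw_span_mull => a b c.
apply: (pbw_span_eval (q := [:: (1, pbw a.+1 b c)])); last exact: pbw_span_word.
by move=> F; rewrite !nc_evalE.
Qed.

(** Induction on the exponent of X^-: H moves to the right by H X^- = X^- H - 2 X^-. *)
Lemma pbw_span_H p : pbw_span p -> pbw_span (nc_mul (ncH K) p).
Proof.
apply: pbw_span_mull => a b c; elim: a => [|a IH].
  apply: (pbw_span_eval (q := [:: (1, pbw 0 b.+1 c)])); last exact: pbw_span_word.
  by move=> F; rewrite !nc_evalE.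
set W := [:: (1, pbw a b c)] in IH.
apply: (@pbw_span_eq _ (nc_add (nc_mul (ncXm K) (nc_mul (ncH K) W))
                               (nc_scale (-2) (nc_mul (ncXm K) W)))).
  have rR : nc_add (nc_comm (ncH K) (ncXm K)) (nc_scale 2 (ncXm K)) \in rel_sl2 K.
    by rewrite !inE eqxx orbT.
  apply: (nc_ideal_eval (ncI_gen (nc_one K) W rR)) => F.
  by rewrite !nc_evalE /= -[pbw a.+1 b c]/(lXm :: pbw a b c); ring.
apply: pbw_span_add; first exact: pbw_span_Xm.
by apply: pbw_span_scale; apply: pbw_span_Xm; apply: pbw_span_word.
Qed.

(** X^+ moves past X^- by X^+ X^- = X^- X^+ + H and, once no X^- is left, past H by X^+ H = H X^+ -
    2 X^+. *)
Lemma pbw_span_Xp p : pbw_span p -> pbw_span (nc_mul (ncXp K) p).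
Proof.
apply: pbw_span_mull => a b c; elim: a => [|a IH].
  elim: b => [|b IH].
    apply: (pbw_span_eval (q := [:: (1, pbw 0 0 c.+1)])); last exact: pbw_span_word.
    by move=> F; rewrite !nc_evalE.
  set W := [:: (1, pbw 0 b c)] in IH.
  apply: (@pbw_span_eq _ (nc_add (nc_mul (ncH K) (nc_mul (ncXp K) W))
                                 (nc_scale (-2) (nc_mul (ncXp K) W)))).
    have rR : nc_add (nc_comm (ncH K) (ncXp K)) (nc_scale (-2) (ncXp K)) \in rel_sl2 K.
      by rewrite !inE eqxx.
    have Ir := nc_ideal_scale (-1) (ncI_gen (nc_one K) W rR).
    apply: (nc_ideal_eval Ir) => F.
    by rewrite !nc_evalE /= -[pbw 0 b.+1 c]/(lH :: pbw 0 b c); ring.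
  by apply: pbw_span_add; [apply: pbw_span_H | apply: pbw_span_scale].
set W := [:: (1, pbw a b c)] in IH.
apply: (@pbw_span_eq _ (nc_add (nc_mul (ncXm K) (nc_mul (ncXp K) W))
                               (nc_mul (ncH K) W))).
  have rR : nc_add (nc_comm (ncXp K) (ncXm K)) (nc_opp (ncH K)) \in rel_sl2 K.
    by rewrite !inE eqxx !orbT.
  apply: (nc_ideal_eval (ncI_gen (nc_one K) W rR)) => F.
  by rewrite !nc_evalE /= -[pbw a.+1 b c]/(lXm :: pbw a b c); ring.
apply: pbw_span_add; first exact: pbw_span_Xm.
by apply: pbw_span_H; apply: pbw_span_word.
Qed.

Lemma letterP (a : letter) : [\/ a = lH, a = lXm | a = lXp].
Proof.
case: a => -[|[|[|//]]] ia; [apply: Or31|apply: Or32|apply: Or33]; exact: val_inj.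
Qed.

Lemma pbw_span_all p : pbw_span p.
Proof.
have sw w : pbw_span [:: (1, w)].
  elim: w => [|a w IH]; first exact: (pbw_span_word 0 0 0).
  apply: (pbw_span_eval (q := nc_mul (nc_gen K a) [:: (1, w)])).
    by move=> F; rewrite !nc_evalE.
  by case: (letterP a) => ->; [apply: pbw_span_H|apply: pbw_span_Xm|apply: pbw_span_Xp].
elim: p => [|t p IH]; first by exists [::] => //; apply: sl2_eq_eval.
apply: (pbw_span_eval (q := nc_add (nc_scale t.1 [:: (1, t.2)]) p)).
  by move=> F; rewrite !nc_evalE.
by apply: pbw_span_add => //; apply: pbw_span_scale.
Qed.

End Presentation.

(** * Faithfulness of U(sl_2) on the family of Verma modules *)

Lemma poly_infinite_roots (R : idomainType) (f : nat -> R) (p : {poly R}) :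
  injective f -> (forall i, p.[f i] = 0) -> p = 0.
Proof.
move=> f_inj pf; apply/eqP; apply: contraT => p_neq0.
have := max_poly_roots (rs := [seq f i | i <- iota 0 (size p)]) p_neq0.
rewrite map_inj_uniq // iota_uniq size_map size_iota ltnn => -> //.
by apply/allP => _ /mapP[i _ ->]; rewrite /root pf.
Qed.

Section Verma.
Variable K : fieldType.
Hypothesis charK : [pchar K] =i pred0.
Implicit Types (n : int) (p q : ncpoly K) (v : vec K) (x y : ncser K).

Lemma natr_inj_pchar0 : injective (fun i : nat => i%:R : K).
Proof.
move=> i j /eqP; wlog ij : i j / (i <= j)%N => [H|].
  by case: (leqP i j) => [|/ltnW] h e; [|apply/esym]; apply: H => //; rewrite eq_sym.
rewrite eq_sym -subr_eq0 -natrB // (pcharf0P K).1 //.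
by rewrite subn_eq0 => ji; apply/eqP; rewrite eqn_leq ij.
Qed.

Lemma natrS_neq0 i : i.+1%:R != 0 :> K.
Proof. by apply/eqP => /(@natr_inj_pchar0 i.+1 0). Qed.

Definition psi_verma : nat -> int -> nat -> K :=
  fun k n m => if m == 0%N then k%:R * (n - k%:Z + 1)%:~R else 0.

Local Notation la := (letter_act psi_verma).

Lemma verma_Xp n v m k :
  la n lXp v m k = k.+1%:R * (n - k%:Z)%:~R * v m k.+1.
Proof.
rewrite /letter_act /= big_ord_recl big1 ?addr0 => [|i _]; last by rewrite mul0r.
rewrite subn0 /psi_verma /=; congr (_ * _ * _); congr (_%:~R); lia.
Qed.

Lemma act_H psi n v m k : letter_act psi n lH v m k = (n - 2 * k%:Z)%:~R * v m k.
Proof. by []. Qed.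

Lemma act_Xm psi n v m k :
  letter_act psi n lXm v m k = if k is k'.+1 then v m k' else 0.
Proof. by []. Qed.

Definition basis_vec (j : nat) : vec K := fun m k => ((m == 0%N) && (k == j))%:R.

Lemma fin_supp_basis j : fin_supp (basis_vec j).
Proof.
move=> m; exists j.+1 => k jk; rewrite /basis_vec.
by case: eqP => // _; case: eqP jk => // ->; rewrite ltnn.
Qed.

Lemma act_H_basis psi n j :
  letter_act psi n lH (basis_vec j) = vec_scale (n - 2 * j%:Z)%:~R (basis_vec j).
Proof.
apply: vec_eq => m k; rewrite /letter_act /= /vec_scale /basis_vec.
by case: (k =P j) => [->|] //; rewrite andbF !mulr0.
Qed.

Lemma act_Xm_basis psi n j : letter_act psi n lXm (basis_vec j) = basis_vec j.+1.
Proof.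
by apply: vec_eq => m [|k]; rewrite /letter_act /= /basis_vec ?andbF // eqSS.
Qed.

Lemma verma_Xp_basis0 n : la n lXp (basis_vec 0) = @vec0 K.
Proof. by apply: vec_eq => m k; rewrite verma_Xp /basis_vec andbF mulr0. Qed.

Lemma verma_Xp_basis n j :
  la n lXp (basis_vec j.+1) = vec_scale (j.+1%:R * (n - j%:Z)%:~R) (basis_vec j).
Proof.
apply: vec_eq => m k; rewrite verma_Xp /vec_scale /basis_vec eqSS.
by case: (k =P j) => [->|] //; rewrite andbF !mulr0.
Qed.

Lemma letter_act0 psi n a : letter_act psi n a (@vec0 K) = @vec0 K.
Proof.
have -> : @vec0 K = vec_scale 0 (@vec0 K) by apply: vec_eq => m k; rewrite /vec_scale mul0r.
by rewrite letter_act_scale; apply: vec_eq => m k; rewrite /vec_scale !mul0r.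
Qed.

Lemma word_act0 psi n w : word_act psi n w (@vec0 K) = @vec0 K.
Proof.
by elim: w => [|a w IH] //; rewrite -[LHS]/(letter_act _ _ a (word_act _ _ w _)) IH letter_act0.
Qed.

(** This is k! n (n - 1) ... (n - k + 1), the scalar by which (X^+)^k takes b_k to b_0. *)
Definition verma_top (n : int) (k : nat) : K :=
  \prod_(i < k) (i.+1%:R * (n - i%:Z)%:~R).

Lemma verma_Xp_pow n k :
  word_act psi_verma n (nseq k lXp) (basis_vec k) = vec_scale (verma_top n k) (basis_vec 0).
Proof.
elim: k => [|k IH].
  by apply: vec_eq => m k; rewrite /verma_top big_ord0 /vec_scale mul1r.
rewrite -addn1 nseqD word_act_cat addn1 /= verma_Xp_basis word_act_scale IH.
apply: vec_eq => m j; rewrite /verma_top big_ord_recr /= /vec_scale; ring.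
Qed.

(** The first k factors bring b_k to a multiple of b_0, and the next one kills it. *)
Lemma verma_Xp_pow0 n k c : (k < c)%N ->
  word_act psi_verma n (nseq c lXp) (basis_vec k) = @vec0 K.
Proof.
move=> kc; have -> : nseq c lXp = nseq (c - k.+1) lXp ++ [:: lXp] ++ nseq k lXp.
  by rewrite -[[:: lXp]]/(nseq 1 lXp) -!nseqD; congr nseq; lia.
rewrite 2!word_act_cat verma_Xp_pow !word_act_scale.
rewrite /= verma_Xp_basis0 word_act0.
by apply: vec_eq => m j; rewrite /vec_scale mulr0.
Qed.

Lemma act_H_pow_basis0 psi n b :
  word_act psi n (nseq b lH) (basis_vec 0) = vec_scale (n%:~R ^+ b) (basis_vec 0).
Proof.
elim: b => [|b IH]; first by apply: vec_eq => m k; rewrite /vec_scale mul1r.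
rewrite -[LHS]/(letter_act _ _ lH (word_act _ _ (nseq b lH) _)) IH letter_act_scale act_H_basis.
by apply: vec_eq => m k; rewrite /vec_scale mulr0 subr0 exprS; ring.
Qed.

Lemma act_Xm_pow_basis0 psi n a :
  word_act psi n (nseq a lXm) (basis_vec 0) = basis_vec a.
Proof.
elim: a => [|a IH] //.
by rewrite -[LHS]/(letter_act _ _ lXm (word_act _ _ (nseq a lXm) _)) IH act_Xm_basis.
Qed.

(** For c = k the power of X^+ ends on b_0, where H^b acts by n^b and (X^-)^a gives b_a; for c > k
    it kills b_k. *)
Lemma verma_pbw n a b c k j : (k <= c)%N ->
  word_act psi_verma n (pbw a b c) (basis_vec k) 0%N j =
  ((c == k) && (a == j))%:R * (n%:~R ^+ b * verma_top n k).
Proof.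
rewrite leq_eqVlt => /orP[/eqP <-|kc].
  rewrite eqxx /= /pbw !word_act_cat verma_Xp_pow !word_act_scale act_H_pow_basis0.
  rewrite word_act_scale act_Xm_pow_basis0 /vec_scale /basis_vec /= eq_sym; ring.
rewrite gtn_eqF //= mul0r /pbw !word_act_cat verma_Xp_pow0 //.
by rewrite !word_act0.
Qed.

(** Counting letters recovers the exponents, so distinct exponents give distinct words
    [pbw a b c]. *)
Definition pbw_exp (w : ncword) := (count_mem lXm w, count_mem lH w, count_mem lXp w).

Lemma pbw_expK a b c : pbw_exp (pbw a b c) = (a, b, c).
Proof. by rewrite /pbw_exp /pbw !count_cat !count_nseq /=; congr (_, _, _); lia. Qed.

(** For n >= k all factors are positive integers, hence nonzero in characteristic zero. This leaves
    infinitely many usable n. *)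
Lemma verma_top_neq0 (i k : nat) : verma_top (i + k)%:Z k != 0.
Proof.
apply/prodf_neq0 => j _; rewrite mulf_neq0 ?natrS_neq0 //.
have -> : (i + k)%:Z - j%:Z = (i + (k - j.+1)).+1%:Z by have := ltn_ord j; lia.
exact: natrS_neq0.
Qed.

(* On b_c a monomial with more than c factors X^+ vanishes, so the coefficients can be
   killed by induction on c: in the b_a-coordinate of the image of b_c only a polynomial
   in n remains, multiplied by verma_top n c. *)
Lemma pbw_form_faithful q : pbw_form q ->
  (forall n k j, nc_act psi_verma n q (basis_vec k) 0%N j = 0) ->
  forall w, nc_coef q w = 0.
Proof.
move=> fq q0; pose S := undup [seq t.2 | t <- q].
have SP w : w \in S -> exists a b c, w = pbw a b c.
  by rewrite mem_undup => /mapP[t /fq tq ->].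
have notS w : w \notin S -> nc_coef q w = 0.
  rewrite mem_undup => wS; rewrite /nc_coef big_seq_cond big1 // => t /andP[tq /eqP tw].
  by rewrite -tw map_f in wS.
suff coef0 c a b : nc_coef q (pbw a b c) = 0.
  by move=> w; case: (boolP (w \in S)) => [/SP[a [b [c ->]]]|/notS].
elim/ltn_ind: c a b => c IH a b.
pose P := \sum_(w <- S | (count_mem lXm w == a) && (count_mem lXp w == c))
            nc_coef q w *: 'X^(count_mem lH w).
have P0 : P = 0.
  (* At n = i + c the factor [verma_top n c] is nonzero and can be cancelled, so P vanishes at
     infinitely many n. *)
  apply: (poly_infinite_roots (f := fun i => (i + c)%:R)) => [i j /natr_inj_pchar0/addIn //|i].
  apply/eqP; rewrite -(inj_eq (mulIf (verma_top_neq0 i c))) mul0r; apply/eqP.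
  rewrite -[RHS](q0 (i + c)%:Z c a) /nc_act (sum_nc_coef q (fun w => _ w _ _ _)) -/S.
  rewrite horner_sum big_distrl big_mkcond /= big_seq [RHS]big_seq.
  apply: eq_bigr => w /SP[a' [b' [c' ->]]].
  have := pbw_expK a' b' c'; rewrite /pbw_exp => -[-> -> ->].
  case: (ltnP c' c) => [c'c|cc'].
    by rewrite IH // scale0r horner0 !mul0r; case: ifP.
  rewrite verma_pbw // andbC; case: ifP => _; rewrite ?mul0r ?mulr0 //.
  by rewrite hornerZ hornerXn mul1r mulrA.
case: (boolP (pbw a b c \in S)) => [wS|/notS //].
(* A word of S with exponents a and c is determined by its exponent of H, so the coefficient of P in
   degree b is a single coefficient of q. *)
have := congr1 (fun R : {poly K} => R`_b) P0; rewrite coef0 coef_sum.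
have := pbw_expK a b c; rewrite /pbw_exp => -[ea eb ec].
rewrite big_mkcond (bigD1_seq (pbw a b c)) ?undup_uniq //= ea eb ec !eqxx /=.
rewrite coefZ coefXn eqxx mulr1 big1_seq ?addr0 // => w /andP[wn wS'].
case: ifP => // /andP[/eqP ea' /eqP ec']; rewrite coefZ coefXn.
case: eqP => [bE|]; last by rewrite mulr0.
have [a' [b' [c' wE]]] := SP _ wS'; case/negP: wn; rewrite wE.
have := pbw_expK a' b' c'; rewrite /pbw_exp -wE -bE ea' ec' => -[-> -> ->].
by apply/eqP.
Qed.

(** The ideal is spanned by products a r b, so it suffices that each relation r acts by zero on
    M(n)[[h]]. *)
Lemma nc_ideal_verma n p v :
  nc_ideal (rel_sl2 K) p -> nc_act psi_verma n p v = @vec0 K.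
Proof.
move=> Ip; elim: Ip v => {p} [p p0|a r b rR|p1 p2 _ I1 _ I2|p1 p2 _ I1 p12] v.
- by apply: vec_eq => m k; apply: (nc_eval_null (fun w => word_act _ _ w _ _ _)).
- rewrite !nc_act_mul.
  have r0 u : nc_act psi_verma n r u = @vec0 K.
    move: rR; rewrite !inE => /or3P[] /eqP ->; apply: vec_eq => m k;
    rewrite !nc_act_add ?nc_act_opp ?nc_act_scale ?nc_act_add ?nc_act_opp !nc_act_mul !nc_act_gen.
    + by rewrite /vec_add /vec_scale /vec0 !(verma_Xp, act_H); ring.
    + by case: k => [|k]; rewrite /vec_add /vec_scale /vec0 !(act_H, act_Xm); ring.
    + by case: k => [|k]; rewrite /vec_add /vec_scale /vec0 !(verma_Xp, act_H, act_Xm); ring.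
  rewrite r0; apply: vec_eq => m k; rewrite /nc_act big1 // => t _.
  by rewrite word_act0 mulr0.
- by rewrite nc_act_add I1 I2; apply: vec_eq => m k; rewrite /vec_add addr0.
- rewrite -(I1 v); apply: vec_eq => m k; apply/esym.
  exact: (nc_eval_coef (fun w => word_act _ _ w _ _ _)).
Qed.

(** Modulo the ideal, p is a combination of Poincare-Birkhoff-Witt monomials. It still acts by zero,
    so its coefficients vanish. *)
Lemma sl2_verma_faithful p :
  (forall n k j, nc_act psi_verma n p (basis_vec k) 0%N j = 0) ->
  nc_ideal (rel_sl2 K) p.
Proof.
move=> p0; have [q fq pq] := pbw_span_all p.
have q0 : forall w, nc_coef q w = 0.
  apply: pbw_form_faithful => // n k j.
  have := congr1 (fun u => u 0%N j) (nc_ideal_verma n (basis_vec k) pq).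
  rewrite nc_act_add nc_act_opp /vec_add /vec_scale p0 add0r mulN1r => /eqP.
  by rewrite oppr_eq0 => /eqP.
apply: (nc_ideal_eval (ncI_add pq (ncI_null _ q0))) => F.
by rewrite !nc_evalE subrK.
Qed.

Lemma Usl2h_eqP x y :
  Usl2h_eq x y <->
  forall n v, fin_supp v -> ser_act psi_verma n x v = ser_act psi_verma n y v.
Proof.
split=> [xy n v _|xy m].
  apply: ser_act_ext => i; have := nc_ideal_verma n v (xy i).
  rewrite nc_act_add nc_act_opp => xy0; apply: vec_eq => m k.
  apply/eqP; rewrite -subr_eq0 -mulN1r.
  by have /(congr1 (fun u => u m k)) /= := xy0; rewrite /vec_add /vec_scale => ->.
(* Verma operators preserve the h-degree and b_k has degree 0, so the h^m coefficient of z b_k sees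
   only z_m. *)
have actE z n k j :
    ser_act psi_verma n z (basis_vec k) m j = nc_act psi_verma n (z m) (basis_vec k) 0%N j.
  rewrite /ser_act big_ord_recr /= subnn big1 ?add0r // => i _.
  have lv : forall p, nc_act psi_verma n p (basis_vec k) (m - i)%N j = 0.
    move=> p; rewrite /nc_act big1 // => t _.
    rewrite (_ : word_act _ _ _ _ _ _ = 0) ?mulr0 //.
    elim: t.2 j => [|a w IH] j' /=.
      by rewrite /basis_vec subn_eq0 leqNgt ltn_ord.
    by case: (letterP a) => ->; rewrite ?verma_Xp /letter_act /= ?IH ?mulr0 //; case: j'.
  exact: lv.
apply: sl2_verma_faithful => n k j; rewrite nc_act_add nc_act_opp /vec_add /vec_scale.
by rewrite -!actE xy ?mulN1r ?subrr //; apply: fin_supp_basis.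
Qed.

End Verma.

(** * Regular colourings as polynomials in the eigenvalues of H and X^- X^+ *)

Lemma horner2_sum (R : comNzRingType) (P : {poly {poly R}}) (a b : R) :
  P.[a%:P].[b] = \sum_(i < size P) \sum_(j < size P`_i) P`_i`_j * b ^+ j * a ^+ i.
Proof.
rewrite (horner_coef P) horner_sum; apply: eq_bigr => i _.
by rewrite hornerM horner_exp hornerC horner_coef big_distrl.
Qed.

Lemma horner2_subst (R : comNzRingType) (P A B : {poly {poly R}}) :
  exists Q : {poly {poly R}}, forall x y : R,
    Q.[x%:P].[y] = P.[(A.[x%:P].[y])%:P].[B.[x%:P].[y]].
Proof.
exists (\sum_(i < size P) \sum_(j < size P`_i) (P`_i`_j)%:P%:P * B ^+ j * A ^+ i).
move=> x y; rewrite [RHS]horner2_sum !horner_sum; apply: eq_bigr => i _.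
rewrite !horner_sum; apply: eq_bigr => j _.
by rewrite !(hornerM, horner_exp, hornerC).
Qed.

Section Regular.
Variable K : fieldType.
Hypothesis charK : [pchar K] =i pred0.

(** On b_k in M(n), z is the eigenvalue of X^- X^+ and s that of H. *)
Definition verma_z (k : nat) (n : int) : K := k%:R * (n - k%:Z + 1)%:~R.
Definition verma_s (k : nat) (n : int) : K := (n - 2 * k%:Z)%:~R.

(** With t = n + 1 and s = n - 2k, the symmetry makes f even in t. Since t^2 = (s + 1)^2 + 4z, f is
    a polynomial in z and s, and its vanishing at k = n + 1, where z = 0, splits off a factor z. *)
Lemma colouring_coef_factor (f : nat -> int -> K) (P : {poly {poly K}}) :
  (forall k n, (0 < k)%N -> f k n = P.[(n%:~R)%:P].[k%:R]) ->
  (forall n : nat, f n.+1 n%:Z = 0) ->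
  (forall k n : nat, (0 < k)%N -> f (n + k).+1 n%:Z = f k (- n%:Z - 2)) ->
  exists G : {poly {poly K}}, forall k n, (0 < k)%N ->
    f k n = verma_z k n * G.[(verma_z k n)%:P].[verma_s k n].
Proof.
move=> fP f0 fsym.
have nz2 : 2%:R != 0 :> K by exact: natrS_neq0.
(* Coordinates t = n + 1 and s = n - 2 k: the symmetry (C3) becomes t -> -t. *)
have [Q QE] : exists Q : {poly {poly K}}, forall t s,
    Q.[t%:P].[s] = P.[(t - 1)%:P].[(t - 1 - s) / 2%:R].
  have [Q QE] := horner2_subst P ('X - 1%:P) (('X - 1%:P - ('X)%:P) * (2%:R^-1)%:P%:P).
  by exists Q => t s; rewrite QE !(hornerE, hornerM, hornerD, hornerN, hornerC, hornerX).
have Qf k n : (0 < k)%N -> f k n = Q.[(n%:~R + 1)%:P].[verma_s k n].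
  move=> k0; rewrite fP // QE addrK; congr (_.[_]).
  by rewrite /verma_s; field.
(* The part of Q odd in t vanishes at infinitely many t and, for each of them, at infinitely many
   s. *)
have odd0 : (odd_poly Q \Po 'X^2) * 'X = 0.
  apply: (poly_infinite_roots (f := fun i : nat => (i.+1%:R)%:P)) => [i j|i].
    by move=> /polyC_inj/(natr_inj_pchar0 charK)[].
  apply: (poly_infinite_roots (f := fun j : nat => - (i.+1 + 2 * j.+1 + 1)%:R)) => [j j'|j].
    by move=> /oppr_inj/(natr_inj_pchar0 charK); lia.
  (* For n = i and k = j + 1 both sides of the symmetry have the same s, while t = i + 1 changes
     sign. *)
  have := fsym j.+1 i isT; rewrite !Qf //.
  set s := verma_s _ _; set s' := verma_s _ _.
  have -> : s = - (i.+1 + 2 * j.+1 + 1)%:R by rewrite /s /verma_s; ring.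
  have -> : s' = - (i.+1 + 2 * j.+1 + 1)%:R by rewrite /s' /verma_s; ring.
  have -> : i%:~R + 1 = i.+1%:R :> K by ring.
  have -> : (- i%:Z - 2)%:~R + 1 = - i.+1%:R :> K by ring.
  (* The even parts cancel, and twice the odd part is left equal to zero. *)
  rewrite -[Q]poly_even_odd !(hornerD, hornerM, horner_comp, hornerX, hornerXn).
  rewrite poly_even_odd polyCN mulrNN hornerN mulrN => /addrI/eqP.
  by rewrite -addr_eq0 -mulr2n -[X in X == _]mulr_natl mulf_eq0 (negbTE nz2) /= => /eqP.
pose e := even_poly Q.
have Qe t : Q.[t] = e.[t ^+ 2].
  by rewrite -[Q]poly_even_odd odd0 addr0 horner_comp hornerXn.
have [F FE] : exists F : {poly {poly K}}, forall z s,
    F.[z%:P].[s] = e.[((s + 1) ^+ 2 + 4%:R * z)%:P].[s].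
  have [F FE] := horner2_subst e ((('X + 1%:P) ^+ 2)%:P + 4%:R%:P%:P * 'X) ('X)%:P.
  by exists F => z s; rewrite FE !(hornerE, hornerM, hornerD, hornerC, hornerX).
have fF k n : (0 < k)%N -> f k n = F.[(verma_z k n)%:P].[verma_s k n].
  move=> k0; rewrite Qf // Qe FE -polyC_exp; congr (_.[_%:P].[_]).
  by rewrite /verma_s /verma_z; ring.
(* The outer variable of F is z. At k = n + 1 one has z = 0 and s = -(n + 2), which gives infinitely
   many roots in s. *)
have F0 : F.[0] = 0.
  apply: (poly_infinite_roots (f := fun i : nat => - (i + 2)%:R)) => [i j|i].
    by move=> /oppr_inj/(natr_inj_pchar0 charK)/addIn.
  have := f0 i; rewrite fF //.
  have -> : verma_z i.+1 i = 0 by rewrite /verma_z; ring.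
  by have -> : verma_s i.+1 i = - (i + 2)%:R by rewrite /verma_s; ring.
have /factor_theorem[G FG] : root F 0 by rewrite /root F0.
exists G => k n k0; rewrite fF // FG subr0 hornerM hornerX hornerM hornerC.
exact: mulrC.
Qed.

(** One element E has to realize the eigenvalues f k n for all n at once. Such functions form an
    algebra containing z and s. *)
Definition verma_diagonal (f : nat -> int -> K) :=
  exists E : ncpoly K, forall n v m k,
    nc_act (psi_verma K) n E v m k = f k n * v m k.

Lemma verma_diagonal_const c : verma_diagonal (fun _ _ => c).
Proof. by exists [:: (c, [::])] => n v m k; rewrite /nc_act big_seq1. Qed.

Lemma verma_diagonal_add f g :
  verma_diagonal f -> verma_diagonal g -> verma_diagonal (fun k n => f k n + g k n).
Proof.
move=> [E hE] [E' hE']; exists (nc_add E E') => n v m k.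
by rewrite nc_act_add /vec_add hE hE' mulrDl.
Qed.

Lemma verma_diagonal_mul f g :
  verma_diagonal f -> verma_diagonal g -> verma_diagonal (fun k n => f k n * g k n).
Proof.
move=> [E hE] [E' hE']; exists (nc_mul E E') => n v m k.
by rewrite nc_act_mul hE hE' mulrA.
Qed.

Lemma verma_diagonal_exp f i :
  verma_diagonal f -> verma_diagonal (fun k n => f k n ^+ i).
Proof.
move=> df; elim: i => [|i IH]; first exact: verma_diagonal_const.
have [E hE] := verma_diagonal_mul df IH.
by exists E => n v m k; rewrite hE exprS.
Qed.

Lemma verma_diagonal_sum (I : Type) (r : seq I) (F : I -> nat -> int -> K) :
  (forall i, verma_diagonal (F i)) ->
  verma_diagonal (fun k n => \sum_(i <- r) F i k n).
Proof.
move=> dF; elim: r => [|i r IH].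
  have [E hE] := verma_diagonal_const 0.
  by exists E => n v m k; rewrite hE big_nil.
have [E hE] := verma_diagonal_add (dF i) IH.
by exists E => n v m k; rewrite hE big_cons.
Qed.

Lemma verma_diagonal_s : verma_diagonal verma_s.
Proof. by exists (ncH K) => n v m k; rewrite nc_act_gen act_H. Qed.

Lemma verma_diagonal_z : verma_diagonal verma_z.
Proof.
exists (nc_mul (ncXm K) (ncXp K)) => n v m k.
rewrite nc_act_mul !nc_act_gen act_Xm; case: k => [|k].
  by rewrite /verma_z !mul0r.
rewrite verma_Xp /verma_z; congr (_ * _%:~R * _); lia.
Qed.

Lemma verma_diagonal_horner2 (G : {poly {poly K}}) :
  verma_diagonal (fun k n => G.[(verma_z k n)%:P].[verma_s k n]).
Proof.
have [|E hE] := @verma_diagonal_sum _ (index_enum 'I_(size G))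
  (fun i k n => \sum_(j < size G`_i) G`_i`_j * verma_s k n ^+ j * verma_z k n ^+ i).
  move=> i; apply: verma_diagonal_sum => j; apply: verma_diagonal_mul.
    apply: verma_diagonal_mul; first exact: verma_diagonal_const.
    by apply: verma_diagonal_exp; apply: verma_diagonal_s.
  by apply: verma_diagonal_exp; apply: verma_diagonal_z.
by exists E => n v m k; rewrite hE horner2_sum.
Qed.

(** The coefficients are X^+ G_i(H, X^- X^+): the diagonal factor scales b_{k+1} by G_i, and X^+
    contributes the missing factor z. *)
Lemma regular_Xp_series (psi : nat -> int -> nat -> K) :
  colouring psi -> regular_colouring psi ->
  exists S : ncser K, S 0%N = ncXp K /\
    forall i n v m k,
      nc_act (psi_verma K) n (S i) v m k = psi k.+1 n i * v m k.+1.
Proof.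
move=> [psi1 psi2 psi3] psireg.
have exE i : exists E : ncpoly K, forall n v m k,
    nc_act (psi_verma K) n E v m k = psi k.+1 n i * v m k.+1.
  have [P hP] := psireg i.
  have [G hG] := colouring_coef_factor (f := fun k n => psi k n i) hP
                   (fun n => psi2 n i) (fun k n => psi3 k n i).
  have [E hE] := verma_diagonal_horner2 G.
  exists (nc_mul (ncXp K) E) => n v m k.
  rewrite nc_act_mul nc_act_gen verma_Xp hE hG // mulrA; congr (_ * _ * _).
  by rewrite /verma_z; congr (_ * _%:~R); lia.
have [S hS] := functional_choice _ exE.
(* In degree 0 the chosen element is replaced by X^+ itself, whose action is the right one by
   (C1). *)
exists (fun i => if i is 0%N then ncXp K else S i); split=> // -[|i] n v m k //.
rewrite nc_act_gen verma_Xp psi1 //; congr (_ * _%:~R * _); lia.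
Qed.

End Regular.

(** * Existence: substitution of a series for X^+ and its h-adic inverse *)

Section Existence.
Variable K : fieldType.
Hypothesis charK : [pchar K] =i pred0.
Variables (psi : nat -> int -> nat -> K) (S : ncser K).
Hypothesis S0 : S 0%N = ncXp K.
Hypothesis S_act : forall i n v m k,
  nc_act (psi_verma K) n (S i) v m k = psi k.+1 n i * v m k.+1.
Implicit Types (n : int) (v : vec K) (x y : ncser K) (p : ncpoly K).

Local Notation psi0 := (psi_verma K).

(** The substitution X^+ -> S, with H and X^- fixed, extended to words, polynomials and series. It
    turns the action on V_h(n, psi) into an action on M(n)[[h]]. *)
Definition sub_letter (a : letter) : ncser K :=
  if a == lXp then S else ser_const (nc_gen K a).
Definition sub_word (w : ncword) : ncser K :=
  foldr (fun a => ser_mul (sub_letter a)) (ser_one K) w.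
Definition sub_nc p : ncser K :=
  fun m => \big[@nc_add K/nc_zero K]_(t <- p) nc_scale t.1 (sub_word t.2 m).
Definition sub_ser x : ncser K :=
  fun m => \big[@nc_add K/nc_zero K]_(i < m.+1) sub_nc (x i) (m - i)%N.

Lemma sub_letter_act n a v : ser_act psi0 n (sub_letter a) v = letter_act psi n a v.
Proof.
case: (letterP a) => ->; rewrite /sub_letter /= ?ser_act_const ?nc_act_gen //.
by apply: vec_eq => m k; apply: eq_bigr => i _; rewrite S_act.
Qed.

Lemma sub_word_act n w v : ser_act psi0 n (sub_word w) v = word_act psi n w v.
Proof.
elim: w => [|a w IH]; first exact: ser_act_one.
by rewrite /= ser_act_mul IH sub_letter_act.
Qed.

Lemma sub_nc_act n p v : ser_act psi0 n (sub_nc p) v = nc_act psi n p v.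
Proof.
apply: vec_eq => m k; rewrite /ser_act /nc_act.
under eq_bigr => i _ do rewrite -/(nc_act psi0 n (sub_nc p i) v (m - i)%N k) nc_act_big.
rewrite exchange_big; apply: eq_bigr => t _; rewrite -sub_word_act big_distrr.
by apply: eq_bigr => i _; rewrite nc_act_scale.
Qed.

Lemma sub_ser_act n x v : ser_act psi0 n (sub_ser x) v = ser_act psi n x v.
Proof.
apply: vec_eq => m k; rewrite /ser_act.
under eq_bigr => j _ do rewrite nc_act_big.
under [RHS]eq_bigr => i _ do rewrite -sub_nc_act.
rewrite /ser_act.
rewrite -(sum_triangle_diag (fun i j => nc_act psi0 n (sub_nc (x i) j) v (m - i - j)%N k)).
by apply: eq_bigr => j _; apply: eq_bigr => i _; rewrite -subnDA subnKC // -ltnS.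
Qed.

Lemma sub_word_act0 n w v : nc_act psi0 n (sub_word w 0%N) v = word_act psi0 n w v.
Proof.
elim: w => [|a w IH]; first exact: nc_act_one.
apply: vec_eq => m k; rewrite /= /ser_mul nc_act_big big_ord1 nc_act_mul IH /sub_letter.
by case: (letterP a) => ->; rewrite /= ?S0 nc_act_gen.
Qed.

Lemma sub_ser_act0 n x v : nc_act psi0 n (sub_ser x 0%N) v = nc_act psi0 n (x 0%N) v.
Proof.
apply: vec_eq => m k; rewrite /sub_ser nc_act_big big_ord1 nc_act_big; apply: eq_bigr => t _.
by rewrite nc_act_scale /vec_scale sub_word_act0.
Qed.

(** This is (x - [sub_ser x]) / h; the dropped constant term acts by zero on M(n)[[h]] by
    [sub_ser_act0]. *)
Definition sub_defect x : ncser K := fun m => nc_add (x m.+1) (nc_opp (sub_ser x m.+1)).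

Lemma verma_act_defect n x v :
  ser_act psi0 n x v =
  vec_add (ser_act psi n x v) (vec_h (ser_act psi0 n (sub_defect x) v)).
Proof.
rewrite -sub_ser_act -ser_act_h -ser_act_add; apply: ser_act_ext => i.
apply: vec_eq => m k; rewrite nc_act_add /vec_add; case: i => [|i].
  by rewrite sub_ser_act0 nc_act_nil addr0.
by rewrite nc_act_add nc_act_opp /vec_add /vec_scale; ring.
Qed.

(* The h-adic solution of g x = x + h g (sub_defect x). *)
Fixpoint b_triv_rec (m : nat) x : ncpoly K :=
  if m is m'.+1 then nc_add (x m) (b_triv_rec m' (sub_defect x)) else x 0%N.
Definition b_triv x : ncser K := fun m => b_triv_rec m x.

Lemma b_triv_defect n x v :
  ser_act psi n (b_triv x) v =
  vec_add (ser_act psi n x v) (vec_h (ser_act psi n (b_triv (sub_defect x)) v)).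
Proof.
rewrite -ser_act_h -ser_act_add; apply: ser_act_ext => -[|i] //.
by apply: vec_eq => m k; rewrite nc_act_add nc_act_nil /vec_add addr0.
Qed.

(** Both sides equal x acting on V_h(n, psi) plus h times the same expression for [sub_defect x], so
    they agree by induction on the h-degree. *)
Lemma b_triv_act n x v : ser_act psi n (b_triv x) v = ser_act psi0 n x v.
Proof.
apply: vec_eq => m k; elim: m x => [|m IH] x;
  by rewrite b_triv_defect verma_act_defect /vec_add /vec_h ?IH.
Qed.

Lemma b_triv_trivialization : b_trivialization psi b_triv.
Proof.
(* Both equalities are tested on actions that [b_triv] identifies; this gives well-definedness and
   injectivity together. *)
have Usl2P x y : Usl2h_eq x y <-> Uhpsi_eq psi (b_triv x) (b_triv y).
  rewrite Uhpsi_eqP (Usl2h_eqP charK).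
  by split=> xy n v fv; have := xy n v fv; rewrite !b_triv_act.
split.
- by move=> x y /Usl2P.
- split=> [x y|c x|x y|]; apply/Uhpsi_eqP => n v fv.
  + by rewrite ser_act_add !b_triv_act ser_act_add.
  + by apply: vec_eq => m k; rewrite b_triv_act !ser_act_scale b_triv_act.
  + by rewrite ser_act_mul !b_triv_act ser_act_mul.
  + by rewrite b_triv_act !ser_act_one.
(* The substitution is a right inverse of [b_triv] up to equality in U_h(psi). *)
- split=> [x y /Usl2P //|y]; exists (sub_ser y).
  by apply/Uhpsi_eqP => n v fv; rewrite b_triv_act sub_ser_act.
- by split; apply/Uhpsi_eqP => n v fv; rewrite b_triv_act !ser_act_const !nc_act_gen.
- split.
  (* The recursion reads g u = u + h g([sub_defect u]), which exhibits the multiple of h. *)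
  + move=> u; exists (b_triv (sub_defect (ser_const u))).
    apply/Uhpsi_eqP => n v fv; rewrite ser_act_add ser_act_opp ser_act_h b_triv_defect.
    by apply: vec_eq => m k; rewrite /vec_add /vec_scale; ring.
  + move=> x y [w /Uhpsi_eqP xyw]; exists (sub_ser w); apply/(Usl2h_eqP charK) => n v fv.
    have := xyw n v fv; rewrite !ser_act_add !ser_act_opp !b_triv_act => ->.
    by rewrite !ser_act_h sub_ser_act.
  + move=> y; exists (sub_ser y), (ser_const (nc_zero K)).
    apply/Uhpsi_eqP => n v fv; apply: vec_eq => m k.
    rewrite ser_act_add ser_act_opp b_triv_act sub_ser_act ser_act_h ser_act_const nc_act_nil.
    by rewrite /vec_add /vec_scale /vec_h mulN1r subrr; case: m.
Qed.

End Existence.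

(** * Uniqueness: the action of an arbitrary trivialization is forced *)

Section Uniqueness.
Variable K : fieldType.
Hypothesis charK : [pchar K] =i pred0.
Variables (psi : nat -> int -> nat -> K) (g : ncser K -> ncser K).
Hypothesis g_triv : b_trivialization psi g.
Implicit Types (n : int) (v : vec K) (x y : ncser K) (p : ncpoly K).

Local Notation psi0 := (psi_verma K).

Definition transports x := forall n v, fin_supp v ->
  ser_act psi n (g x) v = ser_act psi0 n x v.

Lemma g_act_eq x y : Usl2h_eq x y ->
  forall n v, fin_supp v -> ser_act psi n (g x) v = ser_act psi n (g y) v.
Proof. by case: g_triv => gwd _ _ _ _ /gwd/Uhpsi_eqP. Qed.

Lemma g_act_add x y n v : fin_supp v ->
  ser_act psi n (g (ser_add x y)) v =
  vec_add (ser_act psi n (g x) v) (ser_act psi n (g y) v).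
Proof.
case: g_triv => _ [gD _ _ _] _ _ _ fv.
by rewrite ((Uhpsi_eqP _ _ _).1 (gD x y)) // ser_act_add.
Qed.

Lemma g_act_mul x y n v : fin_supp v ->
  ser_act psi n (g (ser_mul x y)) v = ser_act psi n (g x) (ser_act psi n (g y) v).
Proof.
case: g_triv => _ [_ _ gM _] _ _ _ fv.
by rewrite ((Uhpsi_eqP _ _ _).1 (gM x y)) // ser_act_mul.
Qed.

Lemma g_act_scale c x n v m k : fin_supp v ->
  ser_act psi n (g (ser_scale c x)) v m k =
  \sum_(i < m.+1) c i * ser_act psi n (g x) v (m - i)%N k.
Proof.
case: g_triv => _ [_ gZ _ _] _ _ _ fv.
by rewrite ((Uhpsi_eqP _ _ _).1 (gZ c x)) // ser_act_scale.
Qed.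

Lemma transports_H : transports (ser_const (ncH K)).
Proof.
case: g_triv => _ _ _ [/Uhpsi_eqP gH _] _ n v fv.
by rewrite gH // !ser_act_const !nc_act_gen.
Qed.

Lemma transports_Xm : transports (ser_const (ncXm K)).
Proof.
case: g_triv => _ _ _ [_ /Uhpsi_eqP gX] _ n v fv.
by rewrite gX // !ser_act_const !nc_act_gen.
Qed.

Lemma transports_one : transports (ser_one K).
Proof.
case: g_triv => _ [_ _ _ /Uhpsi_eqP g1] _ _ _ n v fv.
by rewrite g1 // !ser_act_one.
Qed.

Lemma transports_add x y : transports x -> transports y -> transports (ser_add x y).
Proof. by move=> tx ty n v fv; rewrite g_act_add // tx // ty // ser_act_add. Qed.

Lemma transports_mul x y : transports x -> transports y -> transports (ser_mul x y).
Proof.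
move=> tx ty n v fv; rewrite g_act_mul // ty // tx ?ser_act_mul //.
exact: fin_supp_ser.
Qed.

Lemma transports_scale c x : transports x -> transports (ser_scale c x).
Proof.
move=> tx n v fv; apply: vec_eq => m k.
by rewrite g_act_scale // tx // ser_act_scale.
Qed.

(** Equal Verma actions mean equality in U(sl_2)[[h]], which g respects. *)
Lemma transports_eq x y :
  (forall n v, ser_act psi0 n x v = ser_act psi0 n y v) -> transports y -> transports x.
Proof.
move=> xy ty n v fv; rewrite (@g_act_eq x y) ?ty //.
by apply/(Usl2h_eqP charK) => n' v' _; apply: xy.
Qed.

(** * The difference D between g(X^+) and the Verma operator X^+ *)

Section Defect.
Variable n : int.

Let D v : vec K :=
  vec_add (ser_act psi n (g (ser_const (ncXp K))) v)
          (vec_scale (-1) (letter_act psi0 n lXp v)).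

Let D_add u v : D (vec_add u v) = vec_add (D u) (D v).
Proof.
rewrite /D ser_act_vadd letter_act_add; apply: vec_eq => m k.
by rewrite /vec_add /vec_scale; ring.
Qed.

Let D_scale c v : D (vec_scale c v) = vec_scale c (D v).
Proof.
rewrite /D ser_act_vscale letter_act_scale; apply: vec_eq => m k.
by rewrite /vec_add /vec_scale; ring.
Qed.

Let D_h v : D (vec_h v) = vec_h (D v).
Proof.
rewrite /D ser_act_vh letter_act_h; apply: vec_eq => -[|m] k //.
by rewrite /vec_add /vec_scale mulr0 addr0.
Qed.

Let X := ser_const (ncXp K).
Let Y := ser_const (ncXm K).
Let H := ser_const (ncH K).

(** Apply g to X^+ X^- = X^- X^+ + H and subtract the same relation in M(n)[[h]]. The actions of X^-
    and H do not involve the colouring, so these terms match. *)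
Let D_Xm v : fin_supp v -> D (letter_act psi n lXm v) = letter_act psi n lXm (D v).
Proof.
move=> fv; apply: vec_eq => m k.
have rel : Usl2h_eq (ser_mul X Y) (ser_add (ser_mul Y X) H).
  apply/(Usl2h_eqP charK) => n' u _; rewrite ser_act_add !ser_act_mul !ser_act_const !nc_act_gen.
  apply: vec_eq => m' [|k']; rewrite /vec_add !(verma_Xp, act_Xm, act_H); ring.
have := congr1 (fun u => u m k) (g_act_eq rel n fv).
have fgX : fin_supp (ser_act psi n (g X) v) by apply: fin_supp_ser.
rewrite g_act_add // !g_act_mul // !transports_Xm // transports_H //.
rewrite !ser_act_const !nc_act_gen /D /vec_add /vec_scale act_H => e.
rewrite [letter_act psi n lXm v](_ : _ = letter_act psi0 n lXm v) // e.
rewrite verma_Xp !act_Xm; case: k {e} => [|k]; rewrite ?verma_Xp; ring.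
Qed.

(** The relation [H, D] = 2D in coordinates, obtained by applying g to H X^+ = X^+ H + 2 X^+. *)
Let D_H v m k : fin_supp v ->
  (n - 2 * k%:Z - 2)%:~R * D v m k = D (letter_act psi n lH v) m k.
Proof.
move=> fv.
have rel : Usl2h_eq (ser_mul H X)
    (ser_add (ser_mul X H) (ser_scale (fun i => (i == 0%N)%:R * 2) X)).
  apply/(Usl2h_eqP charK) => n' u _; apply: vec_eq => m' k'.
  rewrite ser_act_add !ser_act_mul /vec_add ser_act_scale !ser_act_const !nc_act_gen.
  rewrite big_ord_recl big1 => [|i _]; last by rewrite !mul0r.
  rewrite subn0 !(verma_Xp, act_H) /= mul1r; ring.
have := congr1 (fun u => u m k) (g_act_eq rel n fv).
have fgX : fin_supp (ser_act psi n (g X) v) by apply: fin_supp_ser.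
rewrite g_act_add // !g_act_mul // !transports_H // /vec_add g_act_scale //.
rewrite big_ord_recl big1 => [|i _]; last by rewrite !mul0r.
rewrite !ser_act_const !nc_act_gen act_H subn0 => e.
rewrite /D /vec_add /vec_scale !verma_Xp act_H.
rewrite [letter_act psi n lH v](_ : _ = letter_act psi0 n lH v) //.
move: e; set a := ser_act _ _ _ _ _ _; set b := ser_act _ _ _ _ _ _ => e.
have -> : b = (n - 2 * k%:Z)%:~R * a - 2 * a by rewrite e /=; ring.
ring.
Qed.

Let D_basis0 : D (basis_vec K 0) = @vec0 K.
Proof.
apply: vec_eq => m k; have := @D_H (basis_vec K 0) m k (@fin_supp_basis K 0).
rewrite act_H_basis D_scale /vec_scale => /eqP; rewrite -subr_eq0 -mulrBl mulf_eq0.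
case/orP => [/eqP e0|/eqP //].
(* The weights n - 2k of b_k and n + 2 of D b_0 differ by 2k + 2, which is nonzero in characteristic
   zero. *)
have : (2 * k + 2)%:R = 0 :> K by rewrite -[RHS]oppr0 -[in RHS]e0; ring.
by rewrite addn2 => /eqP; rewrite (negbTE (natrS_neq0 charK _)).
Qed.

(* Write v = c b_0 + X^- v1 + h v2. *)
Let D_step v : fin_supp v -> exists v1 v2, [/\ fin_supp v1, fin_supp v2 &
  D v = vec_add (letter_act psi n lXm (D v1)) (vec_h (D v2))].
Proof.
move=> fv.
(* Only the h^0 part of v is divided by X^-; everything of positive h-degree goes into v2. *)
pose v1 : vec K := fun i j => if i is 0%N then v 0%N j.+1 else 0.
pose v2 : vec K := fun i j => v i.+1 j.
have f1 : fin_supp v1.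
  move=> [|i]; last by exists 0%N.
  by have [N hN] := fv 0%N; exists N => j Nj; apply: hN; apply: leqW.
have f2 : fin_supp v2 by move=> i; apply: (fv i.+1).
exists v1, v2; split=> //.
have vE : v = vec_add (vec_scale (v 0%N 0%N) (basis_vec K 0))
                (vec_add (letter_act psi n lXm v1) (vec_h v2)).
  apply: vec_eq => -[|i] [|j]; rewrite /vec_add /vec_scale act_Xm;
    by rewrite /basis_vec /v1 /v2 /vec_h /=; ring.
rewrite {1}vE !D_add D_scale D_h D_basis0 D_Xm //.
by apply: vec_eq => m k; rewrite {1}/vec_add /vec_scale /vec0 mulr0 add0r.
Qed.

(** By [D_step] the coefficient at (m, k) comes from those at (m, k - 1) and (m - 1, k) for other
    vectors, so induction on m and then on k applies. *)
Let D0 v : fin_supp v -> D v = @vec0 K.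
Proof.
move=> fv; apply: vec_eq => m k.
elim: m k v fv => [|m IHm] k; elim: k => [|k IHk] v /D_step[v1 [v2 [f1 f2 ->]]];
  by rewrite /vec_add act_Xm /vec_h ?IHk ?IHm ?addr0.
Qed.

Lemma g_act_Xp v : fin_supp v ->
  ser_act psi n (g (ser_const (ncXp K))) v = letter_act psi0 n lXp v.
Proof.
move=> fv; apply: vec_eq => m k; apply/eqP; rewrite -subr_eq0 -mulN1r.
by have /(congr1 (fun u => u m k)) := D0 fv; rewrite /D /vec_add /vec_scale => ->.
Qed.

End Defect.

Lemma transports_Xp : transports (ser_const (ncXp K)).
Proof. by move=> n v fv; rewrite g_act_Xp // ser_act_const nc_act_gen. Qed.

Lemma transports_word w : transports (ser_const [:: (1, w)]).
Proof.
elim: w => [|a w IH]; first exact: transports_one.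
apply: (@transports_eq _ (ser_mul (ser_const (nc_gen K a)) (ser_const [:: (1, w)]))).
  by move=> n v; rewrite ser_act_mul !ser_act_const nc_act_gen !nc_act_word.
apply: transports_mul => //.
by case: (letterP a) => ->; [apply: transports_H|apply: transports_Xm|apply: transports_Xp].
Qed.

Lemma transports_const p : transports (ser_const p).
Proof.
elim: p => [|t p IH].
  apply: (@transports_eq _ (ser_scale (fun=> 0) (ser_one K))).
    move=> n v; apply: vec_eq => m k; rewrite ser_act_const nc_act_nil ser_act_scale.
    by rewrite big1 // => i _; rewrite mul0r.
  by apply: transports_scale; apply: transports_one.
(* The scalar [t.1] enters as a constant series, since linearity of g is over K[[h]]. *)
apply: (@transports_eq _ (ser_add
  (ser_scale (fun i => (i == 0%N)%:R * t.1) (ser_const [:: (1, t.2)])) (ser_const p))).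
  move=> n v; rewrite ser_act_add !ser_act_const; apply: vec_eq => m k.
  rewrite /vec_add ser_act_scale big_ord_recl big1 => [|i _]; last by rewrite !mul0r.
  by rewrite ser_act_const nc_act_word subn0 /nc_act big_cons mul1r addr0.
by apply: transports_add => //; apply: transports_scale; apply: transports_word.
Qed.

(** The scalar series [(i == 1)] is h, so scaling by it is a shift. *)
Lemma sum_delta1 (f : nat -> K) m :
  \sum_(i < m.+1) (i == 1%N :> nat)%:R * f (m - i)%N = if m is m'.+1 then f m' else 0.
Proof.
rewrite big_ord_recl mul0r add0r; case: m => [|m]; first by rewrite big_ord0.
by rewrite big_ord_recl big1 => [|i _]; rewrite ?mul0r // mul1r addr0 subSS subn0.
Qed.

(** Writing x = x_0 + h x' and using g(h x') = h g(x'), induction on the h-degree passes from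
    constants to series. Linearity over K[[h]] thus replaces h-adic continuity of g. *)
Lemma transports_all x : transports x.
Proof.
move=> n v fv.
have step z : exists z', ser_act psi0 n z v =
    vec_add (ser_act psi0 n (ser_const (z 0%N)) v) (vec_h (ser_act psi0 n z' v)) /\
  ser_act psi n (g z) v =
    vec_add (ser_act psi0 n (ser_const (z 0%N)) v) (vec_h (ser_act psi n (g z') v)).
  pose z' : ncser K := fun i => z i.+1.
  have zE n' u : ser_act psi0 n' z u =
      vec_add (ser_act psi0 n' (ser_const (z 0%N)) u) (vec_h (ser_act psi0 n' z' u)).
    rewrite -ser_act_h -ser_act_add; apply: ser_act_ext => -[|i] //.
    by apply: vec_eq => ? ?; rewrite nc_act_add nc_act_nil /vec_add addr0.
  exists z'; split=> //.
  rewrite (@g_act_eq z (ser_add (ser_const (z 0%N))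
                         (ser_scale (fun i => (i == 1%N)%:R) z'))) //.
    rewrite g_act_add // transports_const //; apply: vec_eq => m k.
    by rewrite /vec_add g_act_scale // (sum_delta1 (fun i => _ i k)).
  apply/(Usl2h_eqP charK) => n' u _; rewrite ser_act_add zE; apply: vec_eq => i j.
  by rewrite /vec_add ser_act_scale (sum_delta1 (fun i => _ i j)).
apply: vec_eq => m; elim: m x => [|m IH] x k; have [z' [-> ->]] := step x.
  by [].
by rewrite /vec_add /vec_h IH.
Qed.

End Uniqueness.

Theorem mainTheorem10 (K : fieldType) (charK : [pchar K] =i pred0)
  (psi : nat -> int -> nat -> K) :
  colouring psi -> regular_colouring psi ->
  (exists g, b_trivialization psi g) /\
  (forall g1 g2, b_trivialization psi g1 -> b_trivialization psi g2 ->
     forall x, Uhpsi_eq psi (g1 x) (g2 x)).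
Proof.
move=> col reg; split=> [|g1 g2 t1 t2 x].
  have [S [S0 S_act]] := regular_Xp_series charK col reg.
  by exists (b_triv S); apply: b_triv_trivialization.
(* Elements of U_h(psi) are compared by their actions, and both images of x act as x does on
   M(n)[[h]]. *)
apply/Uhpsi_eqP => n v fv.
by rewrite (transports_all charK t1) // (transports_all charK t2).
Qed.
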